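(* Let $\lambda > 0$, let the penalty function $g_{\lambda}(x) = f(x) + \lambda \phi(x)$ be bounded below on $A$, let $\Phi$ be an approximation of the penalty term $\phi$, and put $F_{\lambda}(x, p) = f(x) + \lambda \Phi(x, p)$. Let a sequence $\{ p_n \} \subset P$ converge to $p_0$, and let a sequence $\{ x_n \} \subset A$ satisfy $$F_{\lambda}(x_n, p_n) \le \inf_{x \in A} F_{\lambda}(x, p_n) + \varepsilon \quad \forall n \in \mathbb{N}$$ for some $\varepsilon \ge 0$. Then $$\inf_{x \in A} g_{\lambda}(x) \le \liminf_{n \to \infty} g_{\lambda}(x_n) \le \limsup_{n \to \infty} g_{\lambda} (x_n) \le \inf_{x \in A} g_{\lambda}(x) + \varepsilon.$$ If, additionally, $f$ and $\phi$ are l.s.c. on $A$, and the set $A$ is closed, then any cluster point $x^*$ of the sequence $\{ x_n \}$ (if one exists) belongs to $A$ and satisfies $g_{\lambda}(x^* ) \le \inf_{x \in A} g_{\lambda}(x) + \varepsilon$.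
   Context: Setting. $X$ is a metric space, $M, A \subset X$ are nonempty, $f \colon X \to \mathbb{R} \cup \{+\infty\}$, $\Omega = M \cap A$, and $f$ is assumed to attain a global minimum on $\Omega$ with finite value. $\phi \colon X \to [0,+\infty]$ satisfies $\phi(x) = 0$ iff $x \in M$. $P$ is a metric space and $p_0 \in P$ is fixed. Approximation: a function $\Phi \colon X \times P \to [0,+\infty]$ is an approximation of $\phi$ if $\Phi(\cdot, p_0) = \phi(\cdot)$ and $\Phi(\cdot, p) \to \phi(\cdot)$ as $p \to p_0$ uniformly on $A$, i.e. for every $\sigma > 0$ there is a neighbourhood $W$ of $p_0$ such that $\Phi(x,p) \le \phi(x) + \sigma$ and $\phi(x) \le \Phi(x,p) + \sigma$ for all $x \in A$, $p \in W$. ''L.s.c. on a set'' means lower semicontinuous at every point of that set. *)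

(* Defs.v *)
From HB Require Import structures.
From mathcomp Require Import all_boot all_order all_algebra.
From mathcomp Require Import all_classical all_reals all_analysis.

Set Implicit Arguments.
Unset Strict Implicit.
Unset Printing Implicit Defensive.

Import Order.TTheory GRing.Theory Num.Theory.
Import numFieldNormedType.Exports.

Local Open Scope classical_set_scope.
Local Open Scope ring_scope.
Local Open Scope ereal_scope.

(* Pointwise version of the library's lower_semicontinuous: f is defined on the
   whole space and the neighbourhoods are those of X, not of the subspace A. *)
Definition lsc_at {R : realType} {X : topologicalType} (f : X -> \bar R)
    (x : X) : Prop :=
  forall a : R, a%:E < f x -> exists2 V, nbhs x V & forall y, V y -> a%:E < f y.

Definition lsc_on {R : realType} {X : topologicalType} (f : X -> \bar R)
    (A : set X) : Prop :=
  forall x, A x -> lsc_at f x.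

Definition attains_finite_min {R : realType} {X : Type} (f : X -> \bar R)
    (Omega : set X) : Prop :=
  exists2 x0, Omega x0 & f x0 \is a fin_num /\ forall x, Omega x -> f x0 <= f x.

Definition bounded_below_on {R : realType} {X : Type} (g : X -> \bar R)
    (A : set X) : Prop :=
  exists m : R, forall x, A x -> m%:E <= g x.

Definition is_approximation {R : realType} {X P : metricType R} (A : set X)
    (phi : X -> \bar R) (p0 : P) (Phi : X -> P -> \bar R) : Prop :=
  [/\ forall x p, 0 <= Phi x p,
      forall x, Phi x p0 = phi x
    & forall sigma : R, (0 < sigma)%R ->
        exists2 W, nbhs p0 W & forall x p, A x -> W p ->
          Phi x p <= phi x + sigma%:E /\ phi x <= Phi x p + sigma%:E].

Definition penalty_fun {R : realType} {X : Type} (f phi : X -> \bar R)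
    (lambda : R) (x : X) : \bar R :=
  f x + lambda%:E * phi x.

Definition approx_penalty_fun {R : realType} {X P : Type} (f : X -> \bar R)
    (Phi : X -> P -> \bar R) (lambda : R) (x : X) (p : P) : \bar R :=
  f x + lambda%:E * Phi x p.

Definition inf_on {R : realType} {X : Type} (A : set X) (h : X -> \bar R) :
    \bar R :=
  ereal_inf [set h x | x in A].

(* Main.v *)
(* Uniform convergence makes F_lambda(., p_n) and g_lambda uniformly close on A,
   so an eps-minimizer of F_lambda(., p_n) is an (eps + delta)-minimizer of
   g_lambda for all large n; the bound passes to cluster points because g_lambda
   is l.s.c. *)
Require Import Defs.
From HB Require Import structures.
From mathcomp Require Import all_boot all_order all_algebra.
From mathcomp Require Import all_classical all_reals all_analysis.
From mathcomp Require Import ring lra.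
Import Order.TTheory GRing.Theory Num.Theory.
Import numFieldNormedType.Exports.
Local Open Scope classical_set_scope.
Local Open Scope ring_scope.
Local Open Scope ereal_scope.

Lemma lte_pdivl_fin (R : realType) (l a : R) (x : \bar R) :
  (0 < l)%R -> (a%:E < l%:E * x) = ((a / l)%:E < x).
Proof.
move=> l0; rewrite -[in LHS](divfK (lt0r_neq0 l0) a) mulrC EFinM.
by rewrite lte_pmul2l.
Qed.

(** When both terms are finite, each gives up half of the slack [r + s - a]. When exactly one is
    [+oo], the finite one gives up 1 and the infinite one covers the rest of [a]. *)
Lemma lte_add_split (R : realType) (a : R) (x y : \bar R) :
  x <> -oo -> y <> -oo -> a%:E < x + y ->
  exists b c : R, [/\ b%:E < x, c%:E < y & a%:E <= b%:E + c%:E].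
Proof.
move: x y => [r| |] [s| |] // _ _.
- rewrite -EFinD lte_fin => ars.
  exists (r - (r + s - a) / 2)%R, (s - (r + s - a) / 2)%R.
  by split; rewrite -?EFinD ?lte_fin ?lee_fin; lra.
- exists (r - 1)%R, (a - r + 1)%R.
  by split; rewrite -?EFinD ?ltry ?lte_fin ?lee_fin//; lra.
- exists (a - s + 1)%R, (s - 1)%R.
  by split; rewrite -?EFinD ?ltry ?lte_fin ?lee_fin//; lra.
- exists a, 0%R.
  by split; rewrite ?ltry// -EFinD addr0.
Qed.

Lemma lsc_atD (R : realType) (X : topologicalType) (f g : X -> \bar R) (x : X) :
  f x <> -oo -> g x <> -oo -> lsc_at f x -> lsc_at g x ->
  lsc_at (fun y => f y + g y) x.
Proof.
move=> fx gx lf lg a /(lte_add_split _ _ _ _ fx gx)[b [c [bf cg abc]]].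
have [V nV fV] := lf _ bf; have [W nW gW] := lg _ cg.
exists (V `&` W); first exact: filterI.
by move=> y [/fV bfy /gW cgy]; apply: (le_lt_trans abc); exact: lteD.
Qed.

Lemma lsc_atZ (R : realType) (X : topologicalType) (l : R) (f : X -> \bar R)
    (x : X) :
  (0 < l)%R -> lsc_at f x -> lsc_at (fun y => l%:E * f y) x.
Proof.
move=> l0 lf a; rewrite lte_pdivl_fin// => /lf[V nV fV].
by exists V => // y /fV; rewrite lte_pdivl_fin.
Qed.

(** If [c < f x], a neighbourhood of [x] on which [f] exceeds [c] would have to meet the sublevel
    set, which belongs to [F]. *)
Lemma lsc_at_cluster_le (R : realType) (X : topologicalType) (F : set_system X)
    (f : X -> \bar R) (c : \bar R) (x : X) :
  lsc_at f x -> cluster F x -> F [set y | f y <= c] -> f x <= c.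
Proof.
move=> lf clx Fc; rewrite leNgt; apply/negP => cfx.
(* [lsc_at] only tests real levels, whereas [c] may be infinite. *)
have [a ca afx] : exists2 a : R, c <= a%:E & a%:E < f x.
  case: c (f x) cfx {Fc} => [c| |] [r| |] //.
  - by exists c.
  - by exists c => //; rewrite ltry.
  - by exists (r - 1)%R; rewrite ?leNye// lte_fin; lra.
  - by exists 0%R; rewrite ?leNye ?ltry.
have [V nV fV] := lf _ afx.
have [y [/= fyc /fV]] := clx _ _ Fc nV.
by rewrite ltNge (le_trans fyc ca).
Qed.

Lemma limn_esup_le_near (R : realType) (u : nat -> \bar R) (c : \bar R) :
  (\forall n \near \oo, u n <= c) -> limn_esup u <= c.
Proof.
(* The upper limit is an infimum of suprema over the members of the filter, and the set where
   [u n <= c] is such a member. *)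
move=> uc; apply: ge_ereal_inf; exists (ereal_sup (u @` [set n | u n <= c])).
  by exists [set n | u n <= c].
by apply/ereal_supP => _ [n /= unc <-].
Qed.

Lemma le_limn_einf (R : realType) (u : nat -> \bar R) (c : \bar R) :
  (forall n, c <= u n) -> c <= limn_einf u.
Proof.
move=> cu; rewrite /limn_einf leeNr; apply: limn_esup_le_near.
by apply: nearW => n; rewrite leeN2.
Qed.

Lemma inf_on_le (R : realType) (X : Type) (A : set X) (g : X -> \bar R) (x : X) :
  A x -> inf_on A g <= g x.
Proof. by move=> Ax; apply: ereal_inf_lbound; exists x. Qed.

Lemma inf_on_leD (R : realType) (X : Type) (A : set X) (g h : X -> \bar R)
    (c : R) :
  (forall x, A x -> g x <= h x + c%:E) -> inf_on A g <= inf_on A h + c%:E.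
Proof.
move=> gh; rewrite -leeBlDr//; apply/ereal_infP => _ [x Ax <-].
by rewrite leeBlDr//; exact: le_trans (inf_on_le _ _ _ _ _ Ax) (gh _ Ax).
Qed.

(** Signs matter here: since [psi x] and [s] are nonnegative, [l] distributes over their sum even
    when [psi x] is [+oo]. *)
Lemma penalty_fun_leD (R : realType) (X : Type) (f phi psi : X -> \bar R)
    (l s : R) (x : X) :
  (0 < l)%R -> (0 <= s)%R -> 0 <= psi x -> phi x <= psi x + s%:E ->
  penalty_fun f phi l x <= penalty_fun f psi l x + (l * s)%:E.
Proof.
move=> l0 s0 psi0 le; rewrite /penalty_fun -addeA leeD2l// EFinM.
by rewrite -ge0_muleDr ?lee_fin// lee_wpmul2l// lee_fin ltW.
Qed.

Theorem proposition5p1 (R : realType) (X P : metricType R) (M A : set X)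
    (f phi : X -> \bar R) (p0 : P)
    (M_neq0 : M !=set0) (A_neq0 : A !=set0)
    (f_proper : forall x, f x <> -oo)
    (f_min : attains_finite_min f (M `&` A))
    (phi_ge0 : forall x, 0 <= phi x)
    (phi_eq0 : forall x, phi x = 0 <-> M x)
    (lambda : R) (lambda_gt0 : (0 < lambda)%R)
    (g_lb : bounded_below_on (penalty_fun f phi lambda) A)
    (Phi : X -> P -> \bar R) (Phi_approx : is_approximation A phi p0 Phi)
    (p_ : nat -> P) (p_cvg : p_ n @[n --> \oo] --> p0)
    (x_ : nat -> X) (x_A : forall n, A (x_ n))
    (eps : R) (eps_ge0 : (0 <= eps)%R)
    (x_min : forall n,
      approx_penalty_fun f Phi lambda (x_ n) (p_ n) <=
      inf_on A (fun x => approx_penalty_fun f Phi lambda x (p_ n)) + eps%:E) :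
  [/\ inf_on A (penalty_fun f phi lambda) <=
        limn_einf (fun n => penalty_fun f phi lambda (x_ n)),
      limn_einf (fun n => penalty_fun f phi lambda (x_ n)) <=
        limn_esup (fun n => penalty_fun f phi lambda (x_ n))
    & limn_esup (fun n => penalty_fun f phi lambda (x_ n)) <=
        inf_on A (penalty_fun f phi lambda) + eps%:E] /\
  (lsc_on f A -> lsc_on phi A -> closed A ->
   forall xstar : X, cluster (x_ n @[n --> \oo]) xstar ->
     A xstar /\
     penalty_fun f phi lambda xstar <=
       inf_on A (penalty_fun f phi lambda) + eps%:E).
Proof.
have [Phi0 _ Phi_unif] := Phi_approx.
set g := penalty_fun f phi lambda.
have near_min d : (0 < d)%R ->
    \forall n \near \oo, g (x_ n) <= inf_on A g + eps%:E + d%:E.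
  move=> d0; have lambda_neq0 := lt0r_neq0 lambda_gt0.
  (* Multiplied by [lambda], this tolerance becomes [d / 2]. It is paid twice: from [g] to [Fn] at
     [x_ n], and from the infimum of [Fn] back to that of [g]. *)
  have s0 : (0 < d / (2 * lambda))%R by rewrite divr_gt0// mulr_gt0.
  have [W nW unifW] := Phi_unif _ s0.
  have : \forall n \near \oo, W (p_ n) := p_cvg _ nW.
  apply: filterS => n Wpn.
  set Fn := penalty_fun f (Phi^~ (p_ n)) lambda.
  have lsE : (lambda * (d / (2 * lambda)) = d / 2)%R by field.
  have gF x : A x -> g x <= Fn x + (d / 2)%:E.
    move=> Ax; rewrite -lsE; apply: penalty_fun_leD => //; first exact: ltW.
    by have [] := unifW _ _ Ax Wpn.
  have Fg x : A x -> Fn x <= g x + (d / 2)%:E.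
    move=> Ax; rewrite -lsE; apply: penalty_fun_leD => //; first exact: ltW.
    by have [] := unifW _ _ Ax Wpn.
  apply: le_trans (gF _ (x_A n)) _.
  have -> : d%:E = (d / 2)%:E + (d / 2)%:E by rewrite -EFinD -splitr.
  rewrite addeA leeD2r//; apply: le_trans (x_min n) _.
  by rewrite addeAC leeD2r//; exact: inf_on_leD.
split.
  split.
  - by apply: le_limn_einf => n; exact: inf_on_le.
  - exact: limn_einf_sup.
  - by apply/lee_addgt0Pr => d d0; apply: limn_esup_le_near; exact: near_min.
move=> lf lphi clA x clx.
have Ax : A x.
  (* The whole sequence lies in [A], so [A] belongs to its image filter and meets every
     neighbourhood of the cluster point. *)
  apply: clA => B nB; apply: clx nB.
  by exists 0%N => // n _; exact: x_A.
split=> //; apply/lee_addgt0Pr => d d0.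
(* [near_min] says that a sublevel set of [g] belongs to the image filter of the sequence; what
   remains is that [g] is l.s.c. at [x]. *)
apply: lsc_at_cluster_le clx (near_min _ d0).
apply: lsc_atD (lf _ Ax) _ => //; last exact: lsc_atZ (lphi _ Ax).
by move=> phiNy; have := mule_ge0 (ltW lambda_gt0 : 0 <= lambda%:E) (phi_ge0 x);
  rewrite phiNy.
Qed.
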